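(* Let $X$ and $Y$ be two quadratic vector fields on $\mathbb{T}^2$. Then the Lie bracket $[X,Y]=(Ay,-Ax,0)$ for some $A\in\mathbb{R}[x,y,z]$ with $\deg A\leq 2$. Moreover, $[X,Y]$ is completely integrable.
   Context: Fix a real number $a>1$ and let $\mathbb{T}^2=\{(x,y,z)\in\mathbb{R}^3:(x^2+y^2-a^2)^2+z^2-1=0\}$. A triple $\chi=(P,Q,R)$ with $P,Q,R\in\mathbb{R}[x,y,z]$ denotes the polynomial vector field $P\frac{\partial}{\partial x}+Q\frac{\partial}{\partial y}+R\frac{\partial}{\partial z}$ in $\mathbb{R}^3$, acting on polynomials as a derivation; its degree is $\max\{\deg P,\deg Q,\deg R\}$, and it is quadratic if its degree is $2$. It is called a vector field on $\mathbb{T}^2$ if $\chi F=KF$ for some $K\in\mathbb{R}[x,y,z]$, where $F=(x^2+y^2-a^2)^2+z^2-1$. The Lie bracket is $[X,Y]=XY-YX$, i.e. for $X=\sum P_i\partial_{x_i}$, $Y=\sum Q_i\partial_{x_i}$ it is $\sum (X(Q_i)-Y(P_i))\partial_{x_i}$. A first integral of $\chi$ on an open set $U$ is a non-constant analytic map $H:U\to\mathbb{R}$ that is constant on all solution curves of $\chi$ contained in $U$ (equivalently $\chi H=0$ on $U$). A vector field in $\mathbb{R}^n$ is completely integrable if it has $n-1$ functionally independent first integrals (here $n=3$). *)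

(* Defs.v *)
From mathcomp Require Import all_boot all_order all_algebra finmap.
From mathcomp Require Import all_classical all_reals all_analysis.
From mathcomp Require Import summability.
(* The notations of mpoly ('X_i, {mpoly R[n]}, ...) clash with those of
   MathComp-Analysis. *)
From mathcomp Require Import -(notations) mpoly.

Set Implicit Arguments.
Unset Strict Implicit.
Unset Printing Implicit Defensive.

Import Order.TTheory GRing.Theory Num.Theory.
Import numFieldNormedType.Exports.

Local Open Scope classical_set_scope.
Local Open Scope ring_scope.

Section PolynomialVectorFields.
Context {R : realType} {n : nat}.
Implicit Types (X Y : n.-tuple (mpoly n R)) (f : mpoly n R).

(* The total degree, with deg 0 = 0. *)
Definition mpoly_deg f : nat := (msize f).-1.

Definition vf_deg X : nat := \max_(i < n) mpoly_deg (tnth X i).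

Definition quadratic X : Prop := vf_deg X = 2.

Definition vf_apply X f : mpoly n R := \sum_(i < n) tnth X i * mderiv i f.

Definition vf_bracket X Y : n.-tuple (mpoly n R) :=
  [tuple vf_apply X (tnth Y i) - vf_apply Y (tnth X i) | i < n].

(* X is a vector field on the hypersurface f = 0; K is the cofactor. *)
Definition vf_on f X : Prop := exists K : mpoly n R, vf_apply X f = K * f.

End PolynomialVectorFields.

Section Integrability.
Context {R : realType} {n : nat}.
Implicit Types (X : n.-tuple (mpoly n R)) (U A : set 'rV[R]_n)
  (H : 'rV[R]_n -> R).

(* Near every p in U, H is the unconditional sum, over all multi-indices m, of
   c_m (q - p)^m. *)
Definition analytic_on U H : Prop :=
  forall p, U p -> exists c : multinom n -> R,
    nbhs p [set q : 'rV[R]_n |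
      partial_sum (fun m : multinom n =>
        c m * \prod_(i < n) (q 0 i - p 0 i) ^+ m i) @ totally --> H q].

(* g restricted to the open interval I is a solution of x' = X(x) that stays in
   U; the values of g outside I are irrelevant. *)
Definition solution_curve U X (I : set R) (g : R -> 'rV[R]_n) : Prop :=
  [/\ open I, is_interval I, (forall t, I t -> U (g t)) &
      forall t (i : 'I_n), I t ->
        is_derive t (1 : R) (fun s => g s 0 i) (meval (g t 0) (tnth X i))].

Definition first_integral U X H : Prop :=
  [/\ analytic_on U H,
      exists p q, [/\ U p, U q & H p != H q] &
      forall I g, solution_curve U X I g ->
        forall s t, I s -> I t -> H (g s) = H (g t)].

(* Sets of n-dimensional Lebesgue measure zero: they can be covered by countably
   many boxes of arbitrarily small total volume. *)
Definition lebesgue_null A : Prop :=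
  forall e : R, 0 < e -> exists a b : nat -> 'rV[R]_n,
    [/\ forall k i, a k 0 i <= b k 0 i,
        A `<=` \bigcup_k [set x | forall i, a k 0 i <= x 0 i <= b k 0 i] &
        (\sum_(0 <= k <oo) (\prod_(i < n) (b k 0 i - a k 0 i))%:E <= e%:E)%E].

(* The gradients of H_1, ..., H_k are linearly independent at almost every point
   of U. *)
Definition functionally_independent U k (H : 'I_k -> 'rV[R]_n -> R) : Prop :=
  lebesgue_null [set p | U p /\
    ~~ row_free (\matrix_(i < k, j < n) 'D_(delta_mx 0 j) (H i) p)].

(* The first integrals are required on the whole of R^n: on a small enough open
   set, every vector field without singularities has n - 1 of them. *)
Definition completely_integrable X : Prop :=
  exists H : 'I_n.-1 -> 'rV[R]_n -> R,
    (forall i, first_integral setT X (H i)) /\ functionally_independent setT H.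

End Integrability.

Section Torus.
Context {R : realType}.

Definition varx : mpoly 3 R := mpolyX R (mnm1 (inord 0)).
Definition vary : mpoly 3 R := mpolyX R (mnm1 (inord 1)).
Definition varz : mpoly 3 R := mpolyX R (mnm1 (inord 2)).

Definition torus_poly (a : R) : mpoly 3 R :=
  (varx ^+ 2 + vary ^+ 2 - mpolyC 3 (a ^+ 2)) ^+ 2 + varz ^+ 2 - 1.

End Torus.

(* Main.v *)
Require Import Defs.
From mathcomp Require Import all_boot all_order all_algebra finmap.
From mathcomp Require Import all_classical all_reals all_analysis.
From mathcomp Require Import summability.
From mathcomp Require Import -(notations) mpoly.
From mathcomp Require Import ring lra.
Set Implicit Arguments.
Unset Strict Implicit.
Unset Printing Implicit Defensive.
Import Order.TTheory GRing.Theory Num.Theory.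
Import numFieldNormedType.Exports.
Local Open Scope classical_set_scope.
Local Open Scope ring_scope.

(* Put g = x^2 + y^2 - a^2, V = (xz, yz, 2(z^2 - 1 - a^2 g)) and
   W = (y, -x, 0). Every quadratic vector field on the torus is k V + A W with
   k constant and A of degree at most 1. Indeed, from
   4 g (x P + y Q) + 2 z R = K (g^2 + z^2 - 1) with deg K <= 1, restriction to
   the circle g = z = 0 gives K = l z; restriction to the cylinder g = 0 then
   determines R up to a multiple of g, and what remains is
   x P + y Q = (l / 4) z (x^2 + y^2).
   As [V, W] = 0, the bracket of k V + A W and l V + B W is D W with
   D = k V(B) - l V(A) + A W(B) - B W(A). Any D W has the first integrals
   x^2 + y^2 and z, whose gradients are independent off the z-axis. *)

(** * Polynomial functions *)

(** Constants and variables generate the polynomial ring; this induction reduces the chain rule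
    below to the rules for constants, coordinates, sums and products. *)
Lemma mpoly_subring_ind (R : comNzRingType) n (T : mpoly n R -> Prop) :
  (forall c, T (mpolyC n c)) -> (forall i, T (mpolyX R (mnm1 i))) ->
  (forall p q, T p -> T q -> T (p + q)) ->
  (forall p q, T p -> T q -> T (p * q)) -> forall p, T p.
Proof.
move=> TC TX TD TM p; elim/mpolyind: p => [|c m p _ _ Tp].
  by rewrite -(mpolyC0 n); exact: TC.
apply: TD => //; rewrite -mul_mpolyC; apply: (TM) => //.
rewrite mpolyXE_id; apply: (big_ind T) => [||i _]; [by rewrite -mpolyC1|exact: TM|].
by elim: (m i) => [|k IHk]; rewrite ?expr0 ?exprS -?mpolyC1 //; apply: (TM).
Qed.

Lemma mderiv_var (R : comNzRingType) n (i j : 'I_n) :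
  mderiv i (mpolyX R (mnm1 j)) = (i == j)%:R.
Proof.
rewrite mderivX mnmE eq_sym; case: eqVneq => [->|_]; last by rewrite scale0r.
have -> : mnm_sub (mnm1 j) (mnm1 j) = mnm0 by apply/mnmP => k; rewrite !mnmE subnn.
by rewrite mpolyX0 scale1r.
Qed.

(** Chain rule along a curve. The curve is given by its coordinate functions, so that only scalar
    derivatives occur, as in [solution_curve]. *)
Lemma is_derive_meval (R : realType) n (g : R -> 'I_n -> R) (dg : 'I_n -> R) t :
  (forall i, is_derive t (1 : R) (fun s => g s i) (dg i)) ->
  forall h : mpoly n R, is_derive t (1 : R) (fun s => meval (g s) h)
    (\sum_i dg i * meval (g t) (mderiv i h)).
Proof.
move=> hg; elim/mpoly_subring_ind => [c|i|p q Hp Hq|p q Hp Hq].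
- under eq_fun do rewrite mevalC.
  apply: is_derive_eq; rewrite big1 // => i _.
  by rewrite mderivC meval0 mulr0.
- under eq_fun do rewrite mevalXU.
  apply: (is_derive_eq (hg i)).
  rewrite (bigD1 i) //= mderiv_var eqxx meval1 mulr1 big1 ?addr0 // => j ji.
  by rewrite mderiv_var (negPf ji) meval0 mulr0.
- under eq_fun do rewrite mevalD.
  apply: is_derive_eq; rewrite -big_split; apply: eq_bigr => i _.
  by rewrite mderivD mevalD mulrDr.
- under eq_fun do rewrite mevalM.
  apply: is_derive_eq; rewrite !scaler_sumr -big_split; apply: eq_bigr => i _ /=.
  by rewrite mderivM mevalD !mevalM /GRing.scale /=; ring.
Qed.

Lemma derive_meval (R : realType) n (h : mpoly n R) (p : 'rV[R]_n) (j : 'I_n) :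
  'D_(delta_mx 0 j) (fun q : 'rV[R]_n => meval (q 0) h) p = meval (p 0) (mderiv j h).
Proof.
have hg i : is_derive (0 : R) (1 : R)
    (fun s : R => (s *: delta_mx 0 j + p : 'rV[R]_n) 0 i) (j == i)%:R.
  under eq_fun do rewrite !mxE eqxx.
  apply: is_derive_eq.
  by rewrite scale0r add0r addr0 [_%:A]mulr1 eq_sym.
have [dh Dh] := is_derive_meval hg h.
(* Both sides are limits of the same difference quotient, taken along the line through [p] in
   direction [j]; the chain rule applies on that line. *)
have -> : 'D_(delta_mx 0 j) (fun q : 'rV[R]_n => meval (q 0) h) p =
   'D_(1 : R) (fun s : R => meval ((s *: delta_mx 0 j + p) 0) h) (0 : R).
  rewrite /derive; apply: (congr1 (fun F : R -> R => lim (F @ 0^'))); apply: funext => s /=.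
  by rewrite addr0 scale0r add0r [s *: (1 : R)]mulr1.
rewrite Dh (bigD1 j) //= big1 => [|i ij]; last by rewrite eq_sym (negPf ij) mul0r.
by rewrite eqxx mul1r addr0 scale0r add0r.
Qed.

(** Substituting [X_i + p_i] for [X_i] gives the Taylor expansion at [p]; it is finite and valid on
    the whole space. *)
Lemma analytic_meval (R : realType) n (h : mpoly n R) (U : set 'rV[R]_n) :
  analytic_on U (fun q => meval (q 0) h).
Proof.
move=> p _.
pose h' := comp_mpoly [tuple mpolyX R (mnm1 i) + mpolyC n (p 0 i) | i < n] h.
exists (fun m => mcoeff m h'); apply: filterE => q /=.
have -> : meval (q 0) h = meval (fun i => q 0 i - p 0 i) h'.
  rewrite comp_mpoly_meval; apply: meval_eq => i.
  by rewrite tnth_mktuple mevalD mevalXU mevalC subrK.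
(* Once a finite set of multi-indices contains the support of [h'], its partial sum is the exact
   value, so the net is eventually constant. *)
apply: cvg_near_cst; first exact: totally_filter.
exists [fset m in msupp h']%fset => // B /= hB.
rewrite mevalE /partial_sum -(big_seq_fsetE _ _ predT
  (fun m => mcoeff m h' * \prod_(i < n) (q 0 i - p 0 i) ^+ m i)) /=.
rewrite [RHS](perm_big [fset m in msupp h']%fset) /=; last first.
  by apply: uniq_perm => [||m]; rewrite ?msupp_uniq ?fset_uniq // !inE.
apply/esym; apply: big_fset_incl => // m _; rewrite !inE => mh.
by rewrite memN_msupp_eq0 // mul0r.
Qed.

(** Along a solution the derivative of [h] is the value of [X h], hence zero; the mean value theorem
    on the interval then makes [h] constant. *)
Lemma first_integral_meval (R : realType) n (X : n.-tuple (mpoly n R)) (h : mpoly n R) U :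
  vf_apply X h = 0 ->
  (exists p q : 'rV[R]_n, [/\ U p, U q & meval (p 0) h != meval (q 0) h]) ->
  first_integral U X (fun q => meval (q 0) h).
Proof.
move=> Xh hU; split => //; first exact: analytic_meval.
move=> I g [oI itvI gU hg].
have dH t : I t -> is_derive t (1 : R) (fun s => meval (g s 0) h) 0.
  move=> It; apply: (is_derive_eq (is_derive_meval (fun i => hg t i It) h)).
  under eq_bigr do rewrite -mevalM.
  by rewrite -raddf_sum -/(vf_apply X h) Xh raddf0.
suff H s t : I s -> I t -> s < t -> meval (g s 0) h = meval (g t 0) h.
  move=> s t Is It; case: (ltgtP s t) => [|ts|-> //]; first exact: H.
  by rewrite (H t s).
move=> Is It st.
have sub x : s <= x <= t -> I x by exact: itvI.
have [c _ /eqP] : exists2 c, c \in `]s, t[%R &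
   meval (g t 0) h - meval (g s 0) h = 0 * (t - s).
  apply: (@MVT _ (fun s => meval (g s 0) h) (fun=> 0)) => // [x|].
    by rewrite in_itv /= => /andP[/ltW sx /ltW xt]; apply: dH; apply: sub; rewrite sx.
  apply: derivable_within_continuous => x; rewrite in_itv /= => /sub/dH.
  by case.
by rewrite mul0r subr_eq0 => /eqP.
Qed.

(** * Rotational vector fields *)

(** Indices are written with [inord], as in [varx], [vary] and [varz], so that [mderiv_xyz] and
    [tnth_I3] rewrite the resulting terms. *)
Lemma sum_I3 (V : nmodType) (F : 'I_3 -> V) :
  \sum_i F i = F (inord 0) + F (inord 1) + F (inord 2).
Proof.
rewrite !big_ord_recl big_ord0 addr0 addrA.
by congr (F _ + F _ + F _); apply: val_inj; rewrite /= inordK.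
Qed.

Lemma I3_ind (P : 'I_3 -> Prop) :
  P (inord 0) -> P (inord 1) -> P (inord 2) -> forall i, P i.
Proof.
move=> P0 P1 P2 i; rewrite -(inord_val i).
by case: i => -[|[|[|//]]] lt_i.
Qed.

Lemma tnth_I3 T (x y z : T) :
  (tnth [tuple x; y; z] (inord 0) = x) * (tnth [tuple x; y; z] (inord 1) = y) *
  (tnth [tuple x; y; z] (inord 2) = z).
Proof. by rewrite !(tnth_nth x) !inordK. Qed.

Lemma eq_tuple3 T (X Y : 3.-tuple T) :
  tnth X (inord 0) = tnth Y (inord 0) -> tnth X (inord 1) = tnth Y (inord 1) ->
  tnth X (inord 2) = tnth Y (inord 2) -> X = Y.
Proof.
by move=> *; apply: eq_from_tnth; elim/I3_ind.
Qed.

Lemma mderiv_xyz (R : realType) :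
  ((mderiv (inord 0) (@varx R) = 1) * (mderiv (inord 0) (@vary R) = 0) *
   (mderiv (inord 0) (@varz R) = 0)) *
  ((mderiv (inord 1) (@varx R) = 0) * (mderiv (inord 1) (@vary R) = 1) *
   (mderiv (inord 1) (@varz R) = 0)) *
  ((mderiv (inord 2) (@varx R) = 0) * (mderiv (inord 2) (@vary R) = 0) *
   (mderiv (inord 2) (@varz R) = 1)).
Proof. by rewrite !mderiv_var -!val_eqE /= !inordK. Qed.

Definition vec3 (R : realType) (x y z : R) : 'rV[R]_3 :=
  \row_(j < 3) [:: x; y; z]`_j.

Lemma vec3E (R : realType) (x y z : R) :
  (vec3 x y z 0 (inord 0) = x) * (vec3 x y z 0 (inord 1) = y) *
  (vec3 x y z 0 (inord 2) = z).
Proof. by rewrite !mxE !inordK. Qed.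

Lemma completely_integrable_rotation (R : realType) (A : mpoly 3 R) :
  completely_integrable [tuple A * vary; - A * varx; 0].
Proof.
pose h : 'I_2 -> mpoly 3 R := fun i => if i == ord0 then varx ^+ 2 + vary ^+ 2 else varz.
exists (fun i p => meval (p 0) (h i)); split.
  move=> i; apply: first_integral_meval.
    rewrite /vf_apply sum_I3 !tnth_I3 /h; case: ifP => _.
      by rewrite !mderivD !expr2 !mderivM !mderiv_xyz; ring.
    by rewrite !mderiv_xyz; ring.
  (* These two points separate both integrals at once. *)
  exists (vec3 1 0 1), (vec3 0 0 0); split=> //.
  rewrite /h; case: ifP => _; rewrite ?mevalD ?expr2 ?mevalM !mevalXU !vec3E.
    by rewrite !mul0r mulr1 !addr0 oner_neq0.
  by rewrite oner_neq0.
(* The gradients are dependent only on the z-axis, which is covered by the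
   degenerate boxes {0} x {0} x [-k, k]. *)
move=> e e0; exists (fun k => vec3 0 0 (- k%:R)), (fun k => vec3 0 0 k%:R).
have box k : \prod_(i < 3) (vec3 0 0 k%:R 0 i - vec3 0 0 (- k%:R) 0 i) = 0 :> R.
  by rewrite big_ord_recl !mxE /= subrr mul0r.
split=> [k i|p [_]|].
- by elim/I3_ind: i; rewrite !vec3E ?lexx // ge0_cp // ler0n.
- move=> rk; have [p0 p1] : p 0 (inord 0) = 0 /\ p 0 (inord 1) = 0.
    apply: contrapT => nz; move/negP: rk; apply.
    apply: inj_row_free => v; set M := \matrix_(i, j) _ => /rowP vM.
    have ME i j : M i j = meval (p 0) (mderiv j (h i)) by rewrite mxE derive_meval.
    (* The rows of [M] are [(2x, 2y, 0)] and [(0, 0, 1)], so the columns of [v M = 0] read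
       [2x v_0 = 0], [2y v_0 = 0] and [v_1 = 0]. *)
    have := vM (inord 0); have := vM (inord 1); have := vM (inord 2).
    rewrite !mxE !big_ord_recl !big_ord0 !ME /h /=.
    rewrite !mderivD !expr2 !mderivM !mderiv_xyz !mulr0 !mul0r !addr0 !add0r.
    rewrite !mulr1 !mul1r !mevalD !mevalXU !meval0 !meval1 !mulr0 !addr0 !add0r mulr1.
    move=> v1 v0y v0x.
    have v0 : v 0 ord0 = 0.
      apply/eqP/negP => /negP v0; apply: nz.
      move/eqP: v0y; move/eqP: v0x; rewrite !mulf_eq0 (negPf v0) /= -!mulr2n !mulrn_eq0 /=.
      by move=> /eqP -> /eqP ->.
    apply/rowP => i; rewrite mxE; case: i => -[|[|//]] lt_i.
      by rewrite -v0; congr (v _ _); apply: val_inj.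
    by rewrite -v1; congr (v _ _); apply: val_inj.
  have [k hk] : exists k : nat, `|p 0 (inord 2)| <= k%:R.
    by exists (Num.trunc `|p 0 (inord 2)|).+1; rewrite ltW // truncnS_gt.
  move: hk; rewrite ler_norml => hk; exists k => //.
  by elim/I3_ind; rewrite !vec3E ?p0 ?p1 ?lexx.
- by under eq_eseriesr do rewrite box; rewrite eseries0 // lee_fin ltW.
Qed.

(** * Classification of the quadratic vector fields on the torus *)

(* The monomials are listed in the order 1, x, y, z, x^2, y^2, z^2, xy, xz, yz;
   missing entries of c count as 0. *)
Definition quad (R : comNzRingType) (c : seq R) (x y z : R) : R :=
  c`_0 + c`_1 * x + c`_2 * y + c`_3 * z + c`_4 * (x * x) + c`_5 * (y * y) + c`_6 * (z * z)
  + c`_7 * (x * y) + c`_8 * (x * z) + c`_9 * (y * z).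

(** The identity is assumed only inside the unit cylinder, where [torus_field_coeffs] can divide by
    [g]; the coefficients are compared by sampling points there. *)
Lemma radial_quad_coeffs (R : realFieldType) (p q : seq R) (k : R) :
  (forall x y z : R, x ^+ 2 + y ^+ 2 < 1 ->
     x * quad p x y z + y * quad q x y z = k * z * (x ^+ 2 + y ^+ 2)) ->
  [/\ [/\ p`_0 = 0, p`_1 = 0, p`_3 = 0, p`_4 = 0 & p`_6 = 0] /\ p`_8 = k,
      [/\ q`_0 = 0, q`_2 = 0, q`_3 = 0, q`_5 = 0 & q`_6 = 0] /\ q`_9 = k &
      [/\ q`_1 = - p`_2, q`_4 = - p`_7, q`_7 = - p`_5 & q`_8 = - p`_9]].
Proof.
rewrite /quad => S.
have h1 : (1 / 2 : R) ^+ 2 + 0 ^+ 2 < 1 by lra.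
have h2 : (- (1 / 2) : R) ^+ 2 + 0 ^+ 2 < 1 by lra.
have h3 : (1 / 4 : R) ^+ 2 + 0 ^+ 2 < 1 by lra.
have h4 : (0 : R) ^+ 2 + (1 / 2) ^+ 2 < 1 by lra.
have h5 : (0 : R) ^+ 2 + (- (1 / 2)) ^+ 2 < 1 by lra.
have h6 : (0 : R) ^+ 2 + (1 / 4) ^+ 2 < 1 by lra.
(* For [y = z = 0] and nonzero [x] the identity reads [p_0 + p_1 x + p_4 x^2 = 0], and three values
   of [x] determine a quadratic. *)
have [P0 P1 P4] : [/\ p`_0 = 0, p`_1 = 0 & p`_4 = 0].
  by move: (S _ _ 0 h1) (S _ _ 0 h2) (S _ _ 0 h3) => *; split; lra.
have [Q0 Q2 Q5] : [/\ q`_0 = 0, q`_2 = 0 & q`_5 = 0].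
  by move: (S _ _ 0 h4) (S _ _ 0 h5) (S _ _ 0 h6) => *; split; lra.
rewrite P0 P1 P4 Q0 Q2 Q5 in S *.
have [P3 P6 P8] : [/\ p`_3 = 0, p`_6 = 0 & p`_8 = k].
  by move: (S _ _ 1 h1) (S _ _ 1 h2) (S _ _ (-1) h1) => *; split; lra.
have [Q3 Q6 Q9] : [/\ q`_3 = 0, q`_6 = 0 & q`_9 = k].
  by move: (S _ _ 1 h4) (S _ _ 1 h5) (S _ _ (-1) h4) => *; split; lra.
rewrite P3 P6 P8 Q3 Q6 Q9 in S *.
(* What remains is [x y (p_2 + q_1 + (p_7 + q_4) x + (p_5 + q_7) y + (p_9 + q_8) z) = 0], so points
   off both axes are needed. *)
have g1 : (1 / 2 : R) ^+ 2 + (1 / 2) ^+ 2 < 1 by lra.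
have g2 : (- (1 / 2) : R) ^+ 2 + (1 / 2) ^+ 2 < 1 by lra.
have g3 : (1 / 2 : R) ^+ 2 + (- (1 / 2)) ^+ 2 < 1 by lra.
have [E1 E2 E3] : [/\ q`_1 = - p`_2, q`_4 = - p`_7 & q`_7 = - p`_5].
  by move: (S _ _ 0 g1) (S _ _ 0 g2) (S _ _ 0 g3) => *; split; lra.
have E4 : q`_8 = - p`_9 by rewrite E1 E2 E3 in S; move: (S _ _ 1 g1); lra.
done.
Qed.

(** Each restriction of the identity is replaced by finitely many evaluations, after which the
    unknown coefficients solve linear equations. *)
Lemma torus_field_coeffs (R : realFieldType) (a : R) (p q r : seq R) (l0 l1 l2 l3 : R) :
  1 < a ->
  (forall x y z : R, 4 * (x ^+ 2 + y ^+ 2 - a ^+ 2) * (x * quad p x y z + y * quad q x y z)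
     + 2 * z * quad r x y z =
     (l0 + l1 * x + l2 * y + l3 * z) *
     ((x ^+ 2 + y ^+ 2 - a ^+ 2) ^+ 2 + z ^+ 2 - 1)) ->
  exists k : R,
  [/\ [/\ p`_0 = 0, p`_1 = 0, p`_3 = 0, p`_4 = 0 & p`_6 = 0] /\ p`_8 = k,
      [/\ q`_0 = 0, q`_2 = 0, q`_3 = 0, q`_5 = 0 & q`_6 = 0] /\ q`_9 = k,
      [/\ q`_1 = - p`_2, q`_4 = - p`_7, q`_7 = - p`_5 & q`_8 = - p`_9],
      [/\ r`_1 = 0, r`_2 = 0, r`_3 = 0 & [/\ r`_7 = 0, r`_8 = 0 & r`_9 = 0]] &
      [/\ r`_0 = 2 * k * (a ^+ 4 - 1), r`_4 = - (2 * k * a ^+ 2),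
          r`_5 = - (2 * k * a ^+ 2) & r`_6 = 2 * k]].
Proof.
move=> a1 H.
have a0 : a != 0 by rewrite gt_eqF //; lra.
have cancel b : a * b = 0 -> b = 0 by move/eqP; rewrite mulf_eq0 (negPf a0) => /eqP.
(* On the circle x^2 + y^2 = a^2, z = 0 only the cofactor survives. *)
have L0 : l0 = 0.
  by have := H a 0 0; have := H (- a) 0 0; rewrite /quad; lra.
have L1 : l1 = 0.
  by apply: cancel; have := H a 0 0; have := H (- a) 0 0; rewrite /quad; lra.
have L2 : l2 = 0.
  by apply: cancel; have := H 0 a 0; have := H 0 (- a) 0; rewrite /quad; lra.
rewrite L0 L1 L2 in H.
(* On the cylinder [g = 0] the first term vanishes and a factor [z] cancels. *)
have cyl (x y z : R) : x ^+ 2 + y ^+ 2 = a ^+ 2 -> z != 0 -> 2 * quad r x y z = l3 * (z ^+ 2 - 1).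
  move=> xy z0; have := H x y z; rewrite xy subrr mulr0 mul0r => E.
  by apply: (mulfI z0); rewrite -[LHS]/(_ * (_ * _)) mulrA [z * 2]mulrC; lra.
(* Four vertical lines of the cylinder, over [(a, 0)], [(-a, 0)], [(0, a)] and [(0, -a)], are
   sampled at [z = 1, -1, 2]: three values for a quadratic in [z], and both signs to separate odd
   from even terms. *)
have cx (e z : R) : z != 0 -> e ^+ 2 = 1 -> 2 * quad r (e * a) 0 z = l3 * (z ^+ 2 - 1).
  by move=> z0 e1; apply: cyl => //; rewrite expr0n addr0 exprMn e1 mul1r.
have cy (e z : R) : z != 0 -> e ^+ 2 = 1 -> 2 * quad r 0 (e * a) z = l3 * (z ^+ 2 - 1).
  by move=> z0 e1; apply: cyl => //; rewrite expr0n add0r exprMn e1 mul1r.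
have n1 : (1 : R) != 0 by lra.
have n1' : (-1 : R) != 0 by lra.
have n2 : (2 : R) != 0 by lra.
have e1 : (1 : R) ^+ 2 = 1 by lra.
have e1' : (-1 : R) ^+ 2 = 1 by lra.
have := cx _ _ n1 e1; have := cx _ _ n1' e1; have := cx _ _ n2 e1.
have := cx _ _ n1 e1'; have := cx _ _ n1' e1'; have := cx _ _ n2 e1'.
have := cy _ _ n1 e1; have := cy _ _ n1' e1; have := cy _ _ n2 e1.
have := cy _ _ n1 e1'; have := cy _ _ n1' e1'; have := cy _ _ n2 e1'.
rewrite /quad => y6 y5 y4 y3 y2 y1 x6 x5 x4 x3 x2 x1.
have R1 : r`_1 = 0 by apply: cancel; lra.
have R2 : r`_2 = 0 by apply: cancel; lra.
have R3 : r`_3 = 0 by lra.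
have R8 : r`_8 = 0 by apply: cancel; lra.
have R9 : r`_9 = 0 by apply: cancel; lra.
have R45 : r`_4 = r`_5 by apply/eqP; rewrite -subr_eq0; apply/eqP/cancel/cancel; lra.
have R6 : 2 * r`_6 = l3 by lra.
have R0 : 2 * (r`_0 + r`_4 * a ^+ 2) = - l3 by lra.
(* The monomial [xy] vanishes on those four lines; the triple 3, 4, 5 gives a rational point of the
   circle off the axes. *)
have R7 : r`_7 = 0.
  apply/cancel/cancel; have := @cyl (3 / 5 * a) (4 / 5 * a) 1 _ n1; rewrite /quad.
  by move=> /(_ ltac:(field)); lra.
clear cx cy y6 y5 y4 y3 y2 y1 x6 x5 x4 x3 x2 x1.
(* By now [2 r = 2 r_4 g + l3 (z^2 - 1)], so the terms in [z (z^2 - 1)] cancel, and [g] divides out,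
   being nonzero since [x^2 + y^2 < 1 < a^2]. *)
have S (x y z : R) : x ^+ 2 + y ^+ 2 < 1 ->
   4 * (x * quad p x y z + y * quad q x y z) =
   z * (l3 * (x ^+ 2 + y ^+ 2 - a ^+ 2) - 2 * r`_4).
  move=> xy1; set g := x ^+ 2 + y ^+ 2 - a ^+ 2.
  have g0 : g != 0 by rewrite lt_eqF // /g; nra.
  apply: (mulfI g0); have := H x y z; rewrite -/g.
  have -> : 2 * z * quad r x y z = z * (2 * r`_4 * g + l3 * (z ^+ 2 - 1)).
    have R0' : r`_0 = - r`_6 - r`_4 * a ^+ 2 by lra.
    by rewrite /quad R0' R1 R2 R3 R7 R8 R9 -R45 /g -R6; ring.
  lra.
(* On the z-axis the left side of [S] vanishes. *)
have R4 : 2 * r`_4 = - (l3 * a ^+ 2).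
  by have := S 0 0 1; rewrite !expr0n /= !addr0 => /(_ ltr01); lra.
exists (l3 / 4).
have {}S (x y z : R) : x ^+ 2 + y ^+ 2 < 1 ->
   x * quad p x y z + y * quad q x y z = l3 / 4 * z * (x ^+ 2 + y ^+ 2).
  by move=> /S E; apply: (@mulfI _ 4); [lra|rewrite E R4; field].
have [HP HQ HPQ] := radial_quad_coeffs S.
have R5 : r`_5 = - (2 * (l3 / 4) * a ^+ 2) by lra.
split => //; split => //; try lra.
have := R0; rewrite (_ : a ^+ 4 = a ^+ 2 * a ^+ 2) -?exprD // R45 R5 => R0'.
by lra.
Qed.

(** * Bounds on the total degree *)

Section Degree.
Context (R : idomainType) (n : nat).
Implicit Types (p q : mpoly n R) (d e : nat).

(* [mmeasure mdeg] is one more than the total degree, and 0 on the zero polynomial. *)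
Definition deg_le d p : bool := (mmeasure mdeg p <= d.+1)%N.

Lemma deg_leW e d p : (e <= d)%N -> deg_le e p -> deg_le d p.
Proof. by rewrite -ltnS => ed /leq_trans; apply. Qed.

Lemma deg_leC d c : deg_le d (mpolyC n c).
Proof. by rewrite /deg_le msizeC; case: eqP. Qed.

Lemma deg_le0 d : deg_le d (0 : mpoly n R).
Proof. by rewrite /deg_le msize0. Qed.

Lemma deg_le_var i : deg_le 1 (mpolyX R (mnm1 i) : mpoly n R).
Proof. by rewrite /deg_le msizeX mdeg1. Qed.

Lemma deg_leD d p q : deg_le d p -> deg_le d q -> deg_le d (p + q).
Proof.
by move=> dp dq; apply: leq_trans (msizeD_le _ _) _; rewrite geq_max; apply/andP.
Qed.

Lemma deg_leN d p : deg_le d (- p) = deg_le d p.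
Proof. by rewrite /deg_le msizeN. Qed.

Lemma deg_leM d e p q : deg_le d p -> deg_le e q -> deg_le (d + e) (p * q).
Proof.
rewrite /deg_le => dp dq; have [->|p0] := eqVneq p 0; first by rewrite mul0r msize0.
have [->|q0] := eqVneq q 0; first by rewrite mulr0 msize0.
rewrite msizeM //; move: (leq_add dp dq); rewrite addSn addnS.
by case: (_ + _)%N.
Qed.

Lemma deg_leCM d c p : deg_le d p -> deg_le d (mpolyC n c * p).
Proof. by move=> dp; rewrite -[d]add0n deg_leM ?deg_leC. Qed.

(** A monomial [m] of the derivative comes from [m + e_i] in [p], whose degree is one higher. *)
Lemma deg_le_mderiv d i p : deg_le d.+1 p -> deg_le d (mderiv i p).
Proof.
move=> dp; rewrite /deg_le msizeE; apply/bigmax_leqP_seq => m + _.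
rewrite mcoeff_msupp mcoeff_mderiv => nz.
have : mnm_add m (mnm1 i) \in msupp p.
  by rewrite mcoeff_msupp; apply: contraNneq nz => ->; rewrite mul0rn.
by move/msize_mdeg_lt; rewrite mdegD mdeg1 addn1 => /leq_trans/(_ dp).
Qed.

(** Each nonconstant monomial gives up one variable that occurs in it. Repeated use writes
    polynomials of degree at most 2 with explicit coefficients. *)
Lemma deg_le_split d p : deg_le d.+1 p ->
  exists (c : R) (q : 'I_n -> mpoly n R),
    (forall i, deg_le d (q i)) /\ p = mpolyC n c + \sum_i mpolyX R (mnm1 i) * q i.
Proof.
move=> dp; rewrite [p]mpolyE big_seq.
apply: (big_ind (fun p => exists (c : R) (q : 'I_n -> mpoly n R),
    (forall i, deg_le d (q i)) /\ p = mpolyC n c + \sum_i mpolyX R (mnm1 i) * q i)).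
- exists 0, (fun=> 0); split=> [i|]; first exact: deg_le0.
  by rewrite mpolyC0 add0r big1 // => i _; rewrite mulr0.
- move=> _ _ [c [q [dq ->]]] [c' [q' [dq' ->]]].
  exists (c + c'), (fun i => q i + q' i); split=> [i|]; first exact: deg_leD.
  rewrite mpolyCD addrACA -big_split /=; congr (_ + _).
  by apply: eq_bigr => i _; rewrite mulrDr.
move=> m mp; rewrite -mul_mpolyC.
have [/forallP m0|/forallPn [i mi]] := boolP [forall i, m i == 0%N].
  have -> : m = mnm0 by apply/mnmP => i; rewrite mnm0E; apply/eqP/m0.
  exists (mcoeff mnm0 p), (fun=> 0); split=> [i|]; first exact: deg_le0.
  by rewrite mpolyX0 mulr1 big1 ?addr0 // => i _; rewrite mulr0.
have Em : m = mnm_add (mnm1 i) (mnm_sub m (mnm1 i)).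
  apply/mnmP => j; rewrite mnmDE mnmBE mnm1E.
  by case: eqVneq => [<-|//]; rewrite subnKC // lt0n.
exists 0, (fun j => if j == i then mpolyC n (mcoeff m p) * mpolyX R (mnm_sub m (mnm1 i)) else 0).
split=> [j|].
  case: ifP => _; last exact: deg_le0.
  apply: deg_leCM.
  rewrite /deg_le msizeX ltnS; move: (leq_trans (msize_mdeg_lt mp) dp).
  by rewrite {1}Em mdegD mdeg1.
rewrite mpolyC0 add0r (bigD1 i) //= eqxx big1 => [|j /negPf ->]; last by rewrite mulr0.
by rewrite addr0 {2}Em mpolyXD; ring.
Qed.

End Degree.

(** * Cofactors and normal form in three variables *)

Lemma nth_mpolyC (R : realType) n (c : seq R) i :
  [seq mpolyC n x | x <- c]`_i = mpolyC n c`_i.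
Proof.
have [lt_i|le_i] := ltnP i (size c); first exact: nth_map.
by rewrite !nth_default ?size_map // mpolyC0.
Qed.

Section ThreeVariables.
Context (R : realType).
Implicit Types p : mpoly 3 R.

Let x := @varx R.
Let y := @vary R.
Let z := @varz R.
Notation C := (@mpolyC 3 R).

Lemma deg_le1E p : deg_le 1 p -> exists c0 c1 c2 c3,
  p = C c0 + C c1 * x + C c2 * y + C c3 * z.
Proof.
case/deg_le_split => c0 [q [dq ->]].
have E i : q i = C (mcoeff mnm0 (q i)) by apply: msize1_polyC; exact: dq.
exists c0, (mcoeff mnm0 (q (inord 0))), (mcoeff mnm0 (q (inord 1))), (mcoeff mnm0 (q (inord 2))).
by rewrite sum_I3 -!E /x /y /z /varx /vary /varz; ring.
Qed.

Lemma deg_le2E p : deg_le 2 p -> exists c, p = quad (map C c) x y z.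
Proof.
case/deg_le_split => c0 [q [dq ->]].
have [a0 [a1 [a2 [a3 Ea]]]] := deg_le1E (dq (inord 0)).
have [b0 [b1 [b2 [b3 Eb]]]] := deg_le1E (dq (inord 1)).
have [d0 [d1 [d2 [d3 Ed]]]] := deg_le1E (dq (inord 2)).
(* The order is that of [quad]; a mixed monomial such as [xy] arises both as [x * y] and as [y * x],
   so two coefficients add. *)
exists [:: c0; a0; b0; d0; a1; b2; d3; a2 + b1; a3 + d1; b3 + d2].
rewrite sum_I3 Ea Eb Ed -/varx -/vary -/varz -/x -/y -/z /quad /= !mpolyCD; ring.
Qed.

Lemma meval_quad c v : meval v (quad (map C c) x y z) =
  quad c (v (inord 0)) (v (inord 1)) (v (inord 2)).
Proof.
by rewrite /quad !nth_mpolyC !(mevalD, mevalM, mevalC, mevalXU).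
Qed.

(** The image of [F] has degree at most 2 + 3, while [F] has degree exactly 4, and degrees add over
    a domain. *)
Lemma deg_torus_cofactor (a : R) (K : mpoly 3 R) (X : 3.-tuple (mpoly 3 R)) :
  (forall i, deg_le 2 (tnth X i)) ->
  vf_apply X (torus_poly a) = K * torus_poly a -> deg_le 1 K.
Proof.
move=> dX E; set F := torus_poly a in E.
set g := x ^+ 2 + y ^+ 2 - C (a ^+ 2).
(* The coefficient of [x^2] in [g] is 1. *)
have dg : ~~ deg_le 1 g.
  rewrite /deg_le -ltnNge; apply: (@leq_ltn_trans (mdeg (mnm_muln (mnm1 (inord 0)) 2 : multinom 3))).
    by rewrite mdegMn mdeg1.
  apply: msize_mdeg_lt; rewrite mcoeff_msupp mcoeffB mcoeffD !mcoeffXn mcoeffC eqxx.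
  have -> : (mnm_muln (mnm1 (inord 1)) 2 == mnm_muln (mnm1 (inord 0)) 2 :> multinom 3) = false.
    apply/negP => /eqP/(congr1 (fun m : multinom 3 => m (inord 0))).
    by rewrite !mulmnE !mnm1E -!val_eqE /= !inordK.
  have -> : (mnm_muln (mnm1 (inord 0)) 2 == mnm0 :> multinom 3) = false.
    by apply/negP => /eqP/(congr1 (@mdeg 3)); rewrite mdegMn mdeg1 mdeg0.
  by rewrite mulr0 subr0 addr0 oner_neq0.
have dz : deg_le 3 (z ^+ 2 - 1).
  by rewrite expr2 deg_leD ?deg_leN -?mpolyC1 ?deg_leC // (@deg_leW _ _ (1 + 1)%N) ?deg_leM ?deg_le_var.
(* Otherwise [g^2 = F - (z^2 - 1)] would have degree at most 3, although [g] has degree at least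
   2. *)
have dF : ~~ deg_le 3 F.
  apply: contra dg => dF; have : deg_le 3 (g * g).
    rewrite (_ : g * g = F - (z ^+ 2 - 1)); first by rewrite deg_leD ?deg_leN.
    by rewrite /F /torus_poly -/x -/y -/z -/g; ring.
  have [->|g0] := eqVneq g 0; first by rewrite deg_le0.
  by rewrite /deg_le msizeM //; case: (mmeasure _ _) => [|[|[|s]]] //; rewrite !addSn !addnS.
have dF4 : deg_le 4 F.
  rewrite (_ : F = g * g + (z ^+ 2 - 1)); last by rewrite /F /torus_poly -/x -/y -/z -/g; ring.
  rewrite deg_leD ?(deg_leW _ dz) //; apply: (@deg_leM _ _ 2 2); rewrite /g !expr2;
  by rewrite !deg_leD ?deg_leN ?deg_leC // (@deg_leM _ _ 1 1) ?deg_le_var.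
have : deg_le 5 (K * F).
  rewrite -E /vf_apply; apply: (big_ind (deg_le 5)) => [||i _]; first exact: deg_le0.
    exact: deg_leD.
  by apply: (@deg_leM _ _ 2 3) => //; apply: deg_le_mderiv.
have [->|K0] := eqVneq K 0; first by rewrite deg_le0.
have F0 : F != 0 by apply: contraNneq dF => ->; exact: deg_le0.
rewrite /deg_le msizeM // -subn1 leq_subLR => dKF.
rewrite /deg_le -ltnNge in dF.
by rewrite -(leq_add2r 5) (leq_trans _ dKF) // leq_add2l.
Qed.

Lemma torus_vector_field (a : R) X : 1 < a -> quadratic X -> vf_on (torus_poly a) X ->
  exists (k : R) (A : mpoly 3 R), deg_le 1 A /\
    X = [tuple C k * x * z + A * y; C k * y * z - A * x;
               2 * C k * (z ^+ 2 - 1 - C (a ^+ 2) * (x ^+ 2 + y ^+ 2 - C (a ^+ 2)))].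
Proof.
move=> a1 qX [K XK].
have dX i : deg_le 2 (tnth X i).
  have : (mpoly_deg (tnth X i) <= vf_deg X)%N by exact: (leq_bigmax i).
  have -> : vf_deg X = 2%N := qX.
  by rewrite /mpoly_deg /deg_le; case: mmeasure.
have [l0 [l1 [l2 [l3 EK]]]] := deg_le1E (deg_torus_cofactor dX XK).
have [p Ep] := deg_le2E (dX (inord 0)).
have [q Eq] := deg_le2E (dX (inord 1)).
have [r Er] := deg_le2E (dX (inord 2)).
have H (u v w : R) : 4 * (u ^+ 2 + v ^+ 2 - a ^+ 2) * (u * quad p u v w + v * quad q u v w)
     + 2 * w * quad r u v w =
     (l0 + l1 * u + l2 * v + l3 * w) *
     ((u ^+ 2 + v ^+ 2 - a ^+ 2) ^+ 2 + w ^+ 2 - 1).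
  have := congr1 (meval (vec3 u v w 0)) XK.
  rewrite EK /vf_apply sum_I3 Ep Eq Er /torus_poly -!mpolyC1 !expr2.
  rewrite !(mderivD, mderivN, mderivM, mderivC, mderiv_xyz).
  rewrite !(mevalD, mevalN, mevalM, mevalC, meval_quad, mevalXU, meval0, meval1, vec3E).
  by move=> <-; ring.
have [k [[[p0 p1 p3 p4 p6] p8] [[q0 q2 q3 q5 q6] q9] [q1 q4 q7 q8]
  [r1 r2 r3 [r7 r8 r9]] [r0 r4 r5 r6]]] := torus_field_coeffs a1 H.
(* [A] collects the terms of the first component divisible by [y]; the relations between [p] and [q]
   make the second component use the same [A]. *)
exists k, (C p`_2 + C p`_5 * y + C p`_7 * x + C p`_9 * z); split.
  by rewrite !deg_leD ?deg_leC // deg_leCM ?deg_le_var.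
apply: eq_tuple3; rewrite !tnth_I3 ?Ep ?Eq ?Er /quad !nth_mpolyC.
- by rewrite p0 p1 p3 p4 p6 p8 !mpolyC0; ring.
- by rewrite q0 q2 q3 q5 q6 q9 q1 q4 q7 q8 !mpolyC0 !mpolyCN; ring.
- by rewrite r0 r1 r2 r3 r4 r5 r6 r7 r8 r9 !mpolyC0; ring.
Qed.

End ThreeVariables.

(** * The bracket of two quadratic fields *)

Theorem theorem2p2 (R : realType) (a : R) (X Y : 3.-tuple (mpoly 3 R)) :
  1 < a ->
  quadratic X -> vf_on (torus_poly a) X ->
  quadratic Y -> vf_on (torus_poly a) Y ->
  (exists A : mpoly 3 R,
      (mpoly_deg A <= 2)%N /\ vf_bracket X Y = [tuple A * vary; - A * varx; 0]) /\
  completely_integrable (vf_bracket X Y).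
Proof.
move=> a1 qX tX qY tY.
have [k [A [dA EX]]] := torus_vector_field a1 qX tX.
have [l [B [dB EY]]] := torus_vector_field a1 qY tY.
pose V : 3.-tuple (mpoly 3 R) := [tuple varx * varz; vary * varz;
  2 * (varz ^+ 2 - 1 - mpolyC 3 (a ^+ 2) * (varx ^+ 2 + vary ^+ 2 - mpolyC 3 (a ^+ 2)))].
pose W : 3.-tuple (mpoly 3 R) := [tuple vary; - varx; 0].
pose D := mpolyC 3 k * vf_apply V B - mpolyC 3 l * vf_apply V A
  + (A * vf_apply W B - B * vf_apply W A).
have EXY : vf_bracket X Y = [tuple D * vary; - D * varx; 0].
  rewrite EX EY; apply: eq_tuple3; rewrite !tnth_I3 tnth_mktuple !tnth_I3 /D /vf_apply !sum_I3 !tnth_I3;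
  rewrite -!mpolyC1 !expr2 !(mderivD, mderivN, mderivM, mderivC, mderiv_xyz, mderiv_mulC).
  - ring.
  - ring.
  - ring.
split; last by rewrite EXY; exact: completely_integrable_rotation.
exists D; split=> //.
have dx : deg_le 1 (@varx R) by exact: deg_le_var.
have dy : deg_le 1 (@vary R) by exact: deg_le_var.
have dz : deg_le 1 (@varz R) by exact: deg_le_var.
have dV i : deg_le 2 (tnth V i).
  have d2 p q : deg_le 1 p -> deg_le 1 q -> deg_le 2 (p * q : mpoly 3 R).
    exact: (@deg_leM _ _ 1 1).
  elim/I3_ind: i; rewrite !tnth_I3; [exact: d2|exact: d2|].
  rewrite -(mpolyC_nat 3 R 2) -!mpolyC1 !expr2.
  by rewrite !(deg_leD, deg_leN, deg_leCM, deg_leC) ?d2.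
have dW i : deg_le 1 (tnth W i).
  by elim/I3_ind: i; rewrite !tnth_I3 ?deg_leN ?deg_le0.
(* The derivatives of a polynomial of degree at most 1 are constants, so applying [Z] to it gives no
   more than the degree of the components of [Z]. *)
have dap e Z p : (forall i, deg_le e (tnth Z i)) -> deg_le 1 p ->
    deg_le e (vf_apply Z p : mpoly 3 R).
  move=> dZ dp; apply: (big_ind (deg_le e)) => [||i _]; first exact: deg_le0.
    exact: deg_leD.
  by rewrite -[e]addn0; apply: deg_leM => //; exact: deg_le_mderiv.
have : deg_le 2 D.
  rewrite !(deg_leD, deg_leN, deg_leCM, dap _ V) //; apply: (@deg_leM _ _ 1 1) => //;
  exact: dap.
by rewrite /mpoly_deg /deg_le; case: mmeasure.
Qed.
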